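(* Let $F$ be a polynomial Euler product (as defined in the context) such that the series $\sum_{n=1}^\infty \alpha(n)/n$ converges. Consider the Volterra integral equation of the second type $$F_1(x) - \int_0^x F_1(t)\,\frac{dt}{t} = E_2(x,F) \qquad (x \ge 0)$$ for an unknown function $F_1:[0,\infty)\to\mathbb{C}$, where a function $F_1$ is called a solution if for every $x\ge 0$ the limit $\lim_{\epsilon\to 0+}\int_\epsilon^x |F_1(t)|\,\frac{dt}{t}$ exists (is finite) and the equation holds. Then for every complex number $A$ the function $$F_1(x) = (f_1(x,F) + A)\,x \qquad (x\ge 0)$$ is a solution of this integral equation, and these functions exhaust all solutions of it.
   Context: A polynomial Euler product is a function $F(s)$ of a complex variable $s=\sigma+it$, defined for $\sigma>1$ by $F(s)=\prod_p F_p(s)=\prod_p\prod_{j=1}^d\left(1-\frac{\alpha_j(p)}{p^s}\right)^{-1}$, where $p$ runs over primes, $\alpha_j(p)\in\mathbb{C}$ with $|\alpha_j(p)|\le 1$ for all $p$ and $1\le j\le d$, and $d$ (the Euler degree) is minimal, i.e. there is a prime $p_0$ with $\prod_{j=1}^d\alpha_j(p_0)\neq 0$. In particular $F_p(1)=\prod_{j=1}^d(1-\alpha_j(p)/p)^{-1}$. The associated Euler totient function is $\varphi(n,F)=n\prod_{p\mid n}F_p(1)^{-1}$ for $n\in\mathbb{N}$. Put $\gamma(p)=p\left(1-\frac{1}{F_p(1)}\right)$, $C(F)=\frac12\prod_p\left(1-\frac{\gamma(p)}{p^2}\right)$, and $\alpha(n)=\mu(n)\prod_{p\mid n}\gamma(p)$,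 where $\mu$ is the Möbius function. For real $x\ge0$ let $E(x,F)=\sum_{n\le x}\varphi(n,F)-C(F)x^2$, and let $E_2(x,F)=E(x,F)$ if $x\notin\mathbb{N}$, and $E_2(x,F)=\frac12\big(E(x-0,F)+E(x+0,F)\big)$ otherwise (one-sided limits). Let $s(x)=0$ if $x\in\mathbb{Z}$ and $s(x)=\frac12-\{x\}$ otherwise, where $\{x\}=x-[x]$ is the fractional part. Define $f_1(x,F)=\sum_{n=1}^\infty\frac{\alpha(n)}{n}\,s\!\left(\frac{x}{n}\right)$ for $x\ge0$. *)

(* Defs.v *)
From HB Require Import structures.
From mathcomp Require Import all_boot all_order all_algebra.
From mathcomp Require Import all_classical all_reals all_analysis.
From mathcomp Require Import complex.

Set Implicit Arguments.
Unset Strict Implicit.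
Unset Printing Implicit Defensive.

Import Order.TTheory GRing.Theory Num.Theory.
Import numFieldNormedType.Exports.

Local Open Scope classical_set_scope.
Local Open Scope ring_scope.
Local Open Scope complex_scope.

(* MathComp-Analysis puts the norm topology on the regular module [R[i]^o]
   rather than on [R[i]] itself; the two types are convertible, and all limits
   of complex-valued functions below are taken in [R[i]^o]. *)

(* An Euler product is given by its coefficients alpha_j(p), j ranging over
   'I_d instead of {1, ..., d}; values at non-prime p are irrelevant. *)
Record polyEulerProduct (R : realType) := PolyEulerProduct {
  euler_degree : nat;
  euler_coef : nat -> 'I_euler_degree -> R[i];
  euler_coef_le1 : forall p (j : 'I_euler_degree),
    prime p -> `|euler_coef p j| <= 1;
  euler_degree_min : exists p0 : nat,
    prime p0 /\ \prod_(j < euler_degree) euler_coef p0 j != 0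
}.

Section EulerProduct.
Variable R : realType.
Implicit Types (F : polyEulerProduct R) (n p : nat) (x t : R) (s : R[i]).

(* n ^ s = exp (s log n) for n > 0 *)
Definition npowc n s : R[i] :=
  (expR (complex.Re s * ln n%:R))%:C *
  (cos (complex.Im s * ln n%:R) +i* sin (complex.Im s * ln n%:R)).

Definition local_factor F p s : R[i] :=
  \prod_(j < euler_degree F) (1 - euler_coef p j / npowc p s)^-1.

(* Only meaningful for Re s > 1, where the product converges. *)
Definition euler_product F s : R[i] :=
  limn (fun N => (\prod_(0 <= p < N | prime p) local_factor F p s) : R[i]^o).

Definition euler_totient F n : R[i] :=
  n%:R * \prod_(p <- primes n) (local_factor F p 1)^-1.

Definition gamma F p : R[i] := p%:R * (1 - 1 / local_factor F p 1).

Definition C_const F : R[i] :=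
  2^-1 * limn (fun N =>
    (\prod_(0 <= p < N | prime p) (1 - gamma F p / p%:R ^+ 2)) : R[i]^o).

Definition moebius n : int :=
  if (0 < n)%N && all (fun p => logn p n == 1%N) (primes n)
  then (-1) ^+ size (primes n) else 0.

Definition alpha F n : R[i] :=
  (moebius n)%:~R * \prod_(p <- primes n) gamma F p.

(* For x >= 0, Num.truncn x is the integer part of x. *)
Definition E_err F x : R[i] :=
  \sum_(1 <= n < (Num.truncn x).+1) euler_totient F n
  - C_const F * (x ^+ 2)%:C.

(* E is only considered on [0, +oo[, so that x = 0 (where no left limit is
   available) is not counted among the natural numbers. *)
Definition E2 F x : R[i] :=
  if (0 < x) && (x \is a Num.nat) then
    2^-1 * (lim ((E_err F t : R[i]^o) @[t --> x^'-])
            + lim ((E_err F t : R[i]^o) @[t --> x^'+]))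
  else E_err F x.

Definition sawtooth x : R :=
  if x \is a Num.int then 0 else 2^-1 - (x - (Num.floor x)%:~R).

Definition f1 F x : R[i] :=
  limn (fun N => (\sum_(1 <= n < N)
    alpha F n / n%:R * (sawtooth (x / n%:R))%:C) : R[i]^o).

(* Lebesgue measure on the full Lebesgue sigma-algebra: the type
   [lebesgueType R] is [R] equipped with the completed (Caratheodory)
   sigma-algebra, whereas [R] itself carries the Borel one. *)
Definition lebesgueType :=
  caratheodory_type ((wlength (idfun : R -> R))^*)%mu.

Local Notation mu :=
  (@completed_lebesgue_measure R : set lebesgueType -> \bar R).

(* The integral over ]0, x] of G(t) dt / t, for complex-valued G. *)
Definition int_dt_t (G : R -> R[i]) x : R[i] :=
  (\int[mu]_(t in `]0, x]) (complex.Re (G t) / t)) +i*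
  (\int[mu]_(t in `]0, x]) (complex.Im (G t) / t)).

(* G is Lebesgue measurable on ]0, x], and the integrals over [eps, x] of
   |G(t)| dt / t, a priori in [0, +oo], have a finite limit as eps -> 0+. *)
Definition abs_int_dt_t (G : R -> R[i]) x : Prop :=
  [/\ measurable_fun (`]0, x] : set lebesgueType)
        (fun t => complex.Re (G t) : R),
      measurable_fun (`]0, x] : set lebesgueType)
        (fun t => complex.Im (G t) : R) &
      exists l : R,
        (\int[mu]_(t in `[eps, x]) (Normc.normc (G t) / t)%:E)%E
          @[eps --> 0^'+] --> l%:E].

(* Values of F1 at negative reals play no role: F1 stands for a function on
   [0, +oo[. *)
Definition volterra_solution F (F1 : R -> R[i]) : Prop :=
  forall x, 0 <= x -> abs_int_dt_t F1 x /\ F1 x - int_dt_t F1 x = E2 F x.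

End EulerProduct.

(* Main.v *)
Require Import Defs.
From HB Require Import structures.
From mathcomp Require Import all_boot all_order all_algebra.
From mathcomp Require Import all_classical all_reals all_analysis.
From mathcomp Require Import measurable_realfun complex.
From mathcomp Require Import ring lra zify.
Import Order.TTheory GRing.Theory Num.Theory.
Import numFieldNormedType.Exports.
Local Open Scope classical_set_scope.
Local Open Scope ring_scope.
Local Open Scope complex_scope.

(* Write a = sum alpha(n)/n and l = sum alpha(n)/n^2 = 2 C(F).  Since
   phi(m,F)/m = sum_(d | m) alpha(d)/d, exchanging sums gives for x > 0
     f_1(x) = a/2 - l x + sum'_(m <= x) phi(m,F)/m,
   where sum' halves the term m = x.  On ]0, x] this is a step function
   plus an affine one, so its integral is elementary, and x f_1(x) minus that
   integral is sum'_(m <= x) phi(m,F) - C(F) x^2 = E_2(x).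
   The difference D of two solutions satisfies D(x) = int_0^x D(t) dt/t.  Hence
   D is bounded, then Lipschitz, on compact subintervals of ]0, oo[, and
   feeding this back into the equation, g(t) = D(t)/t has increments that are
   quadratically small in the increment of t; so g is constant. *)

Set Implicit Arguments.
Unset Strict Implicit.

(** The series $\sum\alpha(n)/n$ may converge only conditionally, so sums are exchanged at a finite
    level: for fixed [x] the jump part of [s(x/n)] is a finite sum over [m], and once the truncation
    in [n] exceeds [x] that part no longer changes. Limits are then taken only in the two series
    defining [a] and [l]. The second converges absolutely because [gamma p] is bounded uniformly in
    the prime [p]. The free constant comes from the operator $G \mapsto G(x) - \int_0^x G(t)\,dt/t$,
    which kills every $t \mapsto At$; for the same reason [a/2] leaves no trace in [E_2]. In the
    converse direction a solution is only measurable and absolutely integrable against $dt/t$, so it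
    cannot be differentiated at the outset; estimates on increments take the place of
    derivatives. *)

Local Notation normc := Normc.normc.
Local Notation completed_mu R :=
  (@completed_lebesgue_measure R : set (lebesgueType R) -> \bar R).

(** * Squarefree divisor sums *)

(** Repeats the test inside [moebius], so that [alpha] vanishes off it by mere unfolding. *)
Definition sqfree (n : nat) : bool :=
  (0 < n)%N && all (fun p => logn p n == 1%N) (primes n).

Lemma primes_mul_prime (p n : nat) : prime p -> (0 < n)%N -> ~~ (p %| n)%N ->
  perm_eq (primes (p * n)) (p :: primes n).
Proof.
move=> pp n0 pn; apply: uniq_perm; first exact: primes_uniq.
  by rewrite /= primes_uniq mem_primes pp n0 (negbTE pn).
by move=> q; rewrite primesM ?(prime_gt0 pp)// (primes_prime pp) !inE.
Qed.

Lemma sqfree_mul_prime (p n : nat) : prime p -> (0 < n)%N -> ~~ (p %| n)%N ->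
  sqfree (p * n) = sqfree n.
Proof.
move=> pp n0 pn; rewrite /sqfree muln_gt0 prime_gt0//= n0/=.
rewrite (perm_all _ (primes_mul_prime pp n0 pn)) /=.
rewrite lognM ?(prime_gt0 pp)// logn_prime// ?eqxx logn_coprime ?prime_coprime//= ?eqxx/=.
apply: eq_in_all => q; rewrite mem_primes => /and3P[qp _ qn].
rewrite lognM ?(prime_gt0 pp)// logn_prime//; case: (eqVneq q p) => // qE.
by move: pn; rewrite -qE qn.
Qed.

Lemma sqfree_primeN (p n : nat) : prime p -> sqfree (p * n) -> ~~ (p %| n)%N.
Proof.
move=> pp; rewrite /sqfree muln_gt0 => /andP[/andP[_ n0] /allP lp].
have pP : p \in primes (p * n) by rewrite primesM ?(prime_gt0 pp)// (primes_prime pp) inE eqxx.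
move: (lp _ pP); rewrite lognM ?(prime_gt0 pp)// logn_prime// eqxx eqSS => /eqP l0.
by apply/negP => pn; move: (logn_gt0 p n); rewrite l0 mem_primes pp n0 pn.
Qed.

(* For distinct primes [ps], this lists the divisors of their product. *)
Fixpoint subset_prods (ps : seq nat) : seq nat :=
  if ps is p :: ps' then subset_prods ps' ++ [seq (p * d)%N | d <- subset_prods ps']
  else [:: 1%N].

(** Induction on [ps]: an admissible [d] either avoids the new prime [p], or is [p * e] where
    squarefreeness keeps [p] out of [e]. These cases are the two halves of the concatenation. *)
Lemma mem_subset_prods (ps : seq nat) (d : nat) : all prime ps -> uniq ps ->
  (d \in subset_prods ps) = sqfree d && all [in ps] (primes d).
Proof.
elim: ps d => [|p ps IH] d /=.
  move=> _ _; rewrite inE; apply/eqP/andP => [->//|[/andP[d0 _] /allP ad]].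
  apply/eqP; rewrite eqn_leq d0 andbT leqNgt; apply/negP => d1.
  by move: (ad (pdiv d)); rewrite mem_primes pdiv_prime// d0 pdiv_dvd => /(_ isT).
move=> /andP[pp pps] /andP[pps' ups]; rewrite mem_cat IH//.
apply/orP/andP.
- case=> [/andP[-> /allP ad]|/mapP[e + ->]].
    by split=> //; apply/allP => q /ad qs; rewrite inE qs orbT.
  rewrite IH// => /andP[se /allP ae]; have e0 : (0 < e)%N by case/andP: se.
  have pe : ~~ (p %| e)%N.
    by apply: contra pps' => pe; apply: ae; rewrite mem_primes pp e0.
  split; first by rewrite sqfree_mul_prime.
  apply/allP => q; rewrite (perm_mem (primes_mul_prime pp e0 pe)) !inE.
  by case: eqP => //= _ /ae.
- move=> [sd /allP ad]; have d0 : (0 < d)%N by case/andP: sd.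
  have [pd|pd] := boolP (p %| d)%N; last first.
    left; rewrite sd; apply/allP => q qd; move: (ad q qd); rewrite inE => /orP[/eqP qE|//].
    by move: qd pd; rewrite mem_primes qE => /and3P[_ _ ->].
  right; have [e dE] : exists e, d = (p * e)%N by exists (d %/ p)%N; rewrite mulnC divnK.
  move: sd ad d0; rewrite dE => {pd dE d} sd ad d0.
  have e0 : (0 < e)%N by move: d0; rewrite muln_gt0 => /andP[].
  have pe := sqfree_primeN pp sd.
  apply: map_f; rewrite IH// -(sqfree_mul_prime pp e0 pe) sd /=.
  apply/allP => q qe; have := ad q; rewrite primesM ?(prime_gt0 pp)// qe orbT => /(_ isT).
  rewrite inE => /orP[/eqP qE|//].
  by move: qe pe; rewrite mem_primes qE => /and3P[_ _ ->].
Qed.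

Lemma subset_prods_uniq (ps : seq nat) : all prime ps -> uniq ps -> uniq (subset_prods ps).
Proof.
elim: ps => //= p ps IH /andP[pp pps] /andP[pps' ups].
rewrite cat_uniq IH//= map_inj_uniq ?IH//; last first.
  by move=> a b /eqP; rewrite eqn_pmul2l ?(prime_gt0 pp)// => /eqP.
rewrite andbT; apply/hasPn => _ /mapP[e he ->]; apply/negP => hpe.
have : (p * e)%N \in subset_prods ps by exact: hpe.
rewrite mem_subset_prods// => /andP[_ /allP/(_ p)].
move: he; rewrite mem_subset_prods// => /andP[/andP[e0 _] _].
rewrite primesM ?(prime_gt0 pp)// (primes_prime pp) inE eqxx => /(_ isT) pps2.
by move: pps'; rewrite (_ : p \in ps).
Qed.

(** Expanding the product picks a subset of [ps] for each term. It is applied with [ps = primes n]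
    for divisor sums and with the primes below [N] for Euler products. *)
Lemma sum_subset_prods (K : comNzRingType) (c h : nat -> K) (ps : seq nat) :
  h 1%N = 1 ->
  (forall p d, prime p -> (0 < d)%N -> ~~ (p %| d)%N -> h (p * d)%N = c p * h d) ->
  all prime ps -> uniq ps ->
  \sum_(d <- subset_prods ps) h d = \prod_(p <- ps) (1 + c p).
Proof.
move=> h1 hM; elim: ps => [|p ps IH] /=; first by rewrite big_seq1 big_nil.
move=> /andP[pp pps] /andP[pps' ups]; rewrite big_cat big_map big_cons /= mulrDl mul1r -IH//.
congr (_ + _); rewrite mulr_sumr big_seq [RHS]big_seq; apply: eq_bigr => d.
rewrite mem_subset_prods// => /andP[/andP[d0 _] /allP ad]; apply: hM => //.
by apply: contra pps' => pd; apply: ad; rewrite mem_primes pp d0.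
Qed.

(** Only squarefree divisors contribute, and they are the products of subsets of [primes n]. *)
Lemma sum_dvd_prod_primes (K : comNzRingType) (c h : nat -> K) (n : nat) :
  h 1%N = 1 ->
  (forall p d, prime p -> (0 < d)%N -> ~~ (p %| d)%N -> h (p * d)%N = c p * h d) ->
  (forall d, ~~ sqfree d -> h d = 0) ->
  (0 < n)%N ->
  \sum_(d <- divisors n) h d = \prod_(p <- primes n) (1 + c p).
Proof.
move=> h1 hM h0 n0.
have pp : all prime (primes n) by apply/allP => p; rewrite mem_primes => /andP[].
rewrite -(sum_subset_prods h1 hM pp (primes_uniq n)).
rewrite (bigID sqfree) /= [X in _ + X]big1// addr0 -big_filter.
apply: perm_big; apply: uniq_perm.
- by rewrite filter_uniq// divisors_uniq.
- by rewrite subset_prods_uniq// primes_uniq.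
move=> d; rewrite mem_filter mem_subset_prods ?primes_uniq// -dvdn_divisors//.
have [/andP[d0 /allP ld]/=|//] := boolP (sqfree d).
apply/idP/allP => [dn p|ad].
  by rewrite !mem_primes n0 => /and3P[-> _ pd]; exact: dvdn_trans dn.
(* Divisibility is tested on prime-power parts; as [d] is squarefree, each part is a bare prime. *)
apply/dvdn_partP => // p pd.
rewrite p_part (eqP (ld p pd)) expn1.
by move: (ad p pd); rewrite /= mem_primes => /and3P[].
Qed.

(** * Integrals for the completed Lebesgue measure *)

(** Solutions are measured on the completed sigma-algebra, whereas the explicit functions below are
    Borel; this carries their measurability over. *)
Lemma borel_lebesgue (R : realType) (A : set R) :
  measurable A -> measurable (A : set (lebesgueType R)).
Proof. exact: sub_caratheodory. Qed.

Lemma borel_lebesgue_fun (R : realType) (D : set R) (f : R -> R) :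
  measurable D -> measurable_fun D f -> measurable_fun (D : set (lebesgueType R)) f.
Proof. by move=> mD mf _ B mB; apply: borel_lebesgue; apply: mf. Qed.

Lemma measurable_itv_lebesgue (R : realType) (i : interval R) :
  measurable ([set` i] : set (lebesgueType R)).
Proof. by apply: borel_lebesgue; exact: measurable_itv. Qed.

Lemma completed_mu_oc (R : realType) (x y : R) : x <= y ->
  completed_mu R [set` `]x, y]] = (y - x)%:E.
Proof.
move=> xy; have -> : completed_mu R [set` `]x, y]] = lebesgue_measure (`]x, y] : set R) by [].
rewrite lebesgue_measure_itv /= lte_fin.
by case: ltgtP xy => // -> _; rewrite subrr.
Qed.

Lemma bounded_integrable_oc (R : realType) (x y : R) (f : R -> R) (M : R) : x <= y ->
  measurable_fun (`]x, y] : set (lebesgueType R)) f -> (forall t, x < t <= y -> `|f t| <= M) ->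
  (completed_mu R).-integrable [set` `]x, y]] (EFin \o f).
Proof.
move=> xy mf fM; apply: measurable_bounded_integrable => //.
- exact: measurable_itv_lebesgue.
- by rewrite [X in (X < _)%E](completed_mu_oc xy) ltry.
- exists M; split; first exact: num_real.
  move=> B MB t /=; rewrite in_itv/= => tx; apply: le_trans (ltW MB).
  exact: fM.
Qed.

Lemma Rintegral_id (R : realType) (x : R) : 0 < x ->
  \int[completed_mu R]_(t in `]0, x]) t = 2^-1 * x ^+ 2.
Proof.
move=> x0; pose idl : lebesgueType R -> measurableTypeR R := fun t => t.
have midl : measurable_fun setT idl.
  by move=> _ B mB; apply: borel_lebesgue; rewrite setTI.
(* Completed and Borel Lebesgue measures agree on Borel sets: the latter is the
   pushforward of the former by the identity. *)
have mE : measurable_fun (setT : set (measurableTypeR R)) (@EFin R).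
  exact: EFin_measurable.
have idi : (completed_mu R).-integrable [set` `]0, x]] (EFin \o idl).
  apply: (bounded_integrable_oc (M := x)); first exact: ltW.
  - by apply: borel_lebesgue_fun => //; exact: measurable_id.
  - by move=> t /andP[t0 tx]; rewrite ger0_norm// ltW.
have := @integral_pushforward _ _ _ _ R idl midl (completed_mu R) `]0, x] EFin.
move=> /(_ mE idi (measurable_itv _)).
rewrite /Rintegral /= => <-.
have -> : pushforward (completed_mu R) idl = @lebesgue_measure R by [].
rewrite integral_itv_obnd_cbnd; last first.
  by apply/measurable_EFinP; exact: measurable_id.
rewrite (@continuous_FTC2 _ _ (fun t => 2^-1 * t ^+ 2)) //=.
- by rewrite expr0n mulr0 oppr0 addr0.
- by apply: continuous_subspaceT => t; exact: cvg_id.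
- split => //.
  + by apply: cvg_at_right_filter; apply: cvgMr; exact: exprn_continuous.
  + by apply: cvg_at_left_filter; apply: cvgMr; exact: exprn_continuous.
- move=> t _; rewrite derive1E deriveM//= derive_cst scaler0 addr0 exp_derive.
  by rewrite /GRing.scale /= expr1 mulr1 -mulr_natl mulrA mulVf// mul1r.
Qed.

Lemma Rintegral_sum d (T : measurableType d) (R : realType)
  (mu : {measure set T -> \bar R}) (D : set T) (I : Type) (s : seq I) (P : pred I) (h : I -> T -> R) :
  measurable D -> (forall i, P i -> mu.-integrable D (EFin \o h i)) ->
  \int[mu]_(x in D) (\sum_(i <- s | P i) h i x) =
  \sum_(i <- s | P i) \int[mu]_(x in D) h i x.
Proof.
move=> mD ih; elim: s => [|i s IH].
  rewrite big_nil (_ : (fun x => _) = cst 0); first by rewrite Rintegral_cst// mul0r.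
  by apply/funext => x; rewrite big_nil.
rewrite big_cons; under eq_Rintegral do rewrite big_cons.
case: ifP => // Pi; rewrite RintegralD// ?IH//; first exact: ih.
have := @integrable_sum _ _ _ mu D mD I s P (fun i => EFin \o h i) ih.
by apply: eq_integrable => // x _; rewrite /= sumEFin.
Qed.

Lemma Rintegral_ge (R : realType) (x c : R) : 0 < c -> 0 <= x ->
  \int[completed_mu R]_(t in `]0, x]) (c <= t)%R%:R = (if c <= x then x - c else 0).
Proof.
move=> c0 x0.
rewrite /Rintegral (_ : (fun t => _) = (fun t : lebesgueType R => (\1_(`[c, +oo[ : set R) t)%:E)); last first.
  by apply/funext => t; rewrite indicE mem_setE in_itv/= andbT.
rewrite integral_indic; [|exact: measurable_itv_lebesgue..].
rewrite (_ : _ `&` _ = [set` `[c, x]]); last first.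
  apply/seteqP; split => t /=; rewrite !in_itv/= ?andbT.
    by move=> [-> /andP[]].
  by move=> /andP[ct ->]; rewrite ct (lt_le_trans c0).
rewrite [LHS](_ : _ = fine (lebesgue_measure (`[c, x] : set R)))//.
rewrite lebesgue_measure_itv /= lte_fin.
by case: ltgtP => //= ->; rewrite subrr.
Qed.

Lemma Rintegral_pt (R : realType) (x c : R) :
  \int[completed_mu R]_(t in `]0, x]) ((t : R) == c)%:R = 0 :> R.
Proof.
rewrite /Rintegral (_ : (fun t => _) = (fun t : R => (\1_(`[c, c] : set R) t)%:E)); last first.
  by apply/funext => t; rewrite indicE mem_setE in_itv/= eq_le andbC.
rewrite integral_indic; [|exact: measurable_itv_lebesgue..].
rewrite [X in fine X](_ : _ = 0%E)//; apply/eqP.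
rewrite eq_le measure_ge0 andbT.
apply: (@le_trans _ _ (completed_mu R [set` `[c, c]])).
  apply: le_measure; rewrite ?inE; last by move=> ? [].
    by apply: measurableI; exact: measurable_itv_lebesgue.
  exact: measurable_itv_lebesgue.
rewrite [X in (X <= _)%E](_ : _ = lebesgue_measure (`[c, c] : set R))//.
by rewrite lebesgue_measure_itv /= ltxx.
Qed.

(** * Step functions with half weight at the jumps *)

Lemma measurable_ge_indic (R : realType) (c : R) :
  measurable_fun setT (fun t : R => (c <= t)%R%:R : R).
Proof.
rewrite (_ : (fun _ => _) = \1_(`[c, +oo[ : set R)); first exact: measurable_indic.
by apply/funext => t; rewrite indicE mem_setE in_itv/= andbT.
Qed.

Lemma measurable_eq_indic (R : realType) (c : R) :
  measurable_fun setT (fun t : R => (t == c)%:R : R).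
Proof.
rewrite (_ : (fun _ => _) = \1_(`[c, c] : set R)); first exact: measurable_indic.
by apply/funext => t; rewrite indicE mem_setE in_itv/= eq_le andbC.
Qed.

Lemma normr_bool_le1 (R : realType) (b : bool) : `|b%:R : R| <= 1.
Proof. by rewrite normr_nat lern1 leq_b1. Qed.

(* Both the sawtooth (0 at integers) and E2 (mean of one-sided limits) count the
   jump at x = m with weight 1/2. *)
Definition half_step (R : realType) (x : R) (m : nat) : R :=
  (m%:R <= x)%R%:R - 2^-1 * (x == m%:R)%:R.

(** The common shape of the real and imaginary parts of [f1 + A]. Jumps beyond [t] vanish, so a
    single [N] above [x] serves for all [t <= x]. *)
Definition step_affine (R : realType) (a b : R) (c : nat -> R) (N : nat) (t : R) : R :=
  a + b * t + \sum_(1 <= m < N) c m * half_step t m.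

Lemma measurable_step_affine (R : realType) (a b : R) c N (D : set R) :
  measurable_fun D (@step_affine R a b c N).
Proof.
apply: measurable_funTS; apply: measurable_funD.
  apply: measurable_funD; first exact: measurable_cst.
  by apply: measurable_funM; [exact: measurable_cst|exact: measurable_id].
apply: measurable_sum => m.
apply: measurable_funM; first exact: measurable_cst.
rewrite /half_step; apply: measurable_funB; first exact: measurable_ge_indic.
by apply: measurable_funM; [exact: measurable_cst|exact: measurable_eq_indic].
Qed.

(** Since a solution is [t] times such functions, this bound is what makes [|F1(t)| / t] integrable
    near 0. *)
Lemma step_affine_bounded (R : realType) (a b : R) c N (x : R) : 0 <= x ->
  exists2 M, 0 <= M & forall t, 0 < t <= x -> `|@step_affine R a b c N t| <= M.
Proof.
move=> x0; exists (`|a| + `|b| * x + \sum_(1 <= m < N) `|c m| * (1 + 2^-1)).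
  apply: addr_ge0; first by rewrite addr_ge0// mulr_ge0.
  by apply: sumr_ge0 => m _; rewrite mulr_ge0// addr_ge0// invr_ge0.
move=> t /andP[t0 tx].
apply: (le_trans (ler_normD _ _)); apply: lerD.
  apply: (le_trans (ler_normD _ _)); rewrite lerD2l normrM.
  by rewrite ler_wpM2l// ger0_norm// ltW.
apply: (le_trans (ler_norm_sum _ _ _)); apply: ler_sum => m _.
rewrite normrM ler_wpM2l// /half_step; apply: (le_trans (ler_normB _ _)).
apply: lerD; first exact: normr_bool_le1.
by rewrite normrM ger0_norm ?invr_ge0// ler_piMr ?invr_ge0// normr_bool_le1.
Qed.

(** Each unit jump at [m] integrates to the positive part of [x - m]; the half weights sit on null
    sets. *)
Lemma Rintegral_step_affine (R : realType) (a b : R) c N (x : R) : 0 < x ->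
  \int[completed_mu R]_(t in `]0, x]) step_affine a b c N t =
  a * x + b * (2^-1 * x ^+ 2) +
  \sum_(1 <= m < N) c m * (if m%:R <= x then x - m%:R else 0).
Proof.
rewrite /step_affine /half_step => x0; have x0' := ltW x0.
have mD := @measurable_itv_lebesgue R `]0, x].
have bi (f : R -> R) (M : R) : measurable_fun setT f -> (forall t, 0 < t <= x -> `|f t| <= M) ->
    (completed_mu R).-integrable [set` `]0, x]] (EFin \o f).
  move=> mf fM; apply: (bounded_integrable_oc (M := M)) => //.
  by apply: borel_lebesgue_fun => //; exact: measurable_funTS.
have ia : (completed_mu R).-integrable [set` `]0, x]] (EFin \o (fun t => a)).
  by apply: (bi _ `|a|) => //; exact: measurable_cst.
have it : (completed_mu R).-integrable [set` `]0, x]] (EFin \o (fun t : R => t)).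
  apply: (bi _ x); first exact: measurable_id.
  by move=> t /andP[t0 tx]; rewrite ger0_norm// ltW.
have ib : (completed_mu R).-integrable [set` `]0, x]] (EFin \o (fun t => b * t)).
  exact: (integrableZl mD b it).
have ige m : (completed_mu R).-integrable [set` `]0, x]]
  (EFin \o (fun t : R => ((m%:R <= t)%R%:R : R))).
  by apply: (bi _ 1) => *; [exact: measurable_ge_indic|exact: normr_bool_le1].
have ieq m : (completed_mu R).-integrable [set` `]0, x]]
  (EFin \o (fun t : R => ((t == m%:R)%:R : R))).
  by apply: (bi _ 1) => *; [exact: measurable_eq_indic|exact: normr_bool_le1].
have ieq2 m : (completed_mu R).-integrable [set` `]0, x]]
  (EFin \o (fun t : R => 2^-1 * ((t == m%:R)%:R : R))).
  exact: (integrableZl mD 2^-1 (ieq m)).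
have iB m : (completed_mu R).-integrable [set` `]0, x]]
  (EFin \o (fun t : R => ((m%:R <= t)%R%:R - 2^-1 * (t == m%:R)%:R : R))).
  exact: (integrableB mD (ige m) (ieq2 m)).
have iS m : (completed_mu R).-integrable [set` `]0, x]]
  (EFin \o (fun t : R => c m * ((m%:R <= t)%R%:R - 2^-1 * (t == m%:R)%:R : R))).
  exact: (integrableZl mD (c m) (iB m)).
rewrite RintegralD//.
- rewrite RintegralD// Rintegral_cst// [X in a * fine X](completed_mu_oc x0') subr0 /=.
  rewrite RintegralZl// Rintegral_id//; congr (_ + _).
  rewrite Rintegral_sum//; apply: eq_big_nat => m /andP[m0 _].
  rewrite RintegralZl// RintegralB// RintegralZl// Rintegral_pt mulr0 subr0.
  by rewrite Rintegral_ge// ltr0n.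
- exact: (integrableD mD ia ib).
- have := @integrable_sum _ _ _ _ _ mD _ (index_iota 1 N) xpredT _ (fun i _ => iS i).
  by apply: eq_integrable => // t _; rewrite /= sumEFin.
Qed.

(** * Convergence of complex series and the constant C(F) *)

Lemma normrCE (R : realType) (z : R[i]) : `|z| = (normc z)%:C.
Proof. by case: z. Qed.

Lemma normc_ge0 (R : realType) (z : R[i]) : 0 <= normc z.
Proof. by rewrite -lecR -normrCE normr_ge0. Qed.

Lemma normcD (R : realType) (x y : R[i]) : normc (x + y) <= normc x + normc y.
Proof. exact: le_normcD. Qed.

Lemma normc_nat (R : realType) (n : nat) : normc (n%:R : R[i]) = n%:R.
Proof. by apply/complexI; rewrite -normrCE normr_nat rmorph_nat. Qed.

Lemma Re_le_normc (R : realType) (z : R[i]) : `|complex.Re z| <= normc z.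
Proof. by rewrite -lecR -normrCE; exact: normc_ge_Re. Qed.

Lemma Im_le_normc (R : realType) (z : R[i]) : `|complex.Im z| <= normc z.
Proof.
case: z => a b /=; rewrite -sqrtr_sqr ler_sqrt ?addr_ge0 ?sqr_ge0//.
by rewrite lerDr sqr_ge0.
Qed.

Lemma normc_le_ReIm (R : realType) (z : R[i]) :
  normc z <= `|complex.Re z| + `|complex.Im z|.
Proof.
case: z => a b /=; rewrite -[leRHS]ger0_norm ?addr_ge0// -sqrtr_sqr ler_sqrt ?sqr_ge0//.
by rewrite sqrrD !real_normK ?num_real// lerD2r lerDl mulrn_wge0// mulr_ge0.
Qed.

Lemma cvg_complexP (R : realType) (T : Type) (F : set_system T) (FF : Filter F)
    (f : T -> R[i]) (l : R[i]) :
  ((f t : R[i]^o) @[t --> F] --> (l : R[i]^o)) <->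
  (complex.Re (f t) @[t --> F] --> complex.Re l) /\
  (complex.Im (f t) @[t --> F] --> complex.Im l).
Proof.
split=> [/cvgrPdist_lt fl|[/cvgrPdist_lt fr /cvgrPdist_lt fi]].
  by split; apply/cvgrPdist_lt => e e0; have := fl e%:C; rewrite ltcR => /(_ e0);
    apply: filterS => t; rewrite normrCE ltcR; apply: le_lt_trans;
    [have := Re_le_normc (l - f t)|have := Im_le_normc (l - f t)];
    rewrite raddfB.
apply/cvgrPdist_lt => e e0.
(* In the partial order of [R[i]], [0 < e] forces [e] to be real. *)
have eE : e = (complex.Re e)%:C by rewrite RRe_real// ger0_real// ltW.
have e20 : 0 < complex.Re e / 2 by rewrite divr_gt0// -ltcR -eE.
have H1 := fr _ e20; have H2 := fi _ e20.
apply: filterS2 H1 H2 => t h1 h2.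
rewrite normrCE eE ltcR; apply: (le_lt_trans (normc_le_ReIm _)).
by rewrite !raddfB /= [ltRHS]splitr ltrD.
Qed.

Lemma cvg_complexD (R : realType) (T : Type) (F : set_system T) (FF : Filter F)
    (f g : T -> R[i]) (a b : R[i]) :
  ((f t : R[i]^o) @[t --> F] --> (a : R[i]^o)) ->
  ((g t : R[i]^o) @[t --> F] --> (b : R[i]^o)) ->
  ((f t + g t : R[i]^o) @[t --> F] --> (a + b : R[i]^o)).
Proof.
move=> /cvg_complexP[fr fi] /cvg_complexP[gr gi]; apply/cvg_complexP.
split; rewrite raddfD; under eq_fun do rewrite raddfD; exact: cvgD.
Qed.

Lemma cvg_complexZl (R : realType) (T : Type) (F : set_system T) (FF : Filter F)
    (f : T -> R[i]) (a c : R[i]) :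
  ((f t : R[i]^o) @[t --> F] --> (a : R[i]^o)) ->
  ((f t * c : R[i]^o) @[t --> F] --> (a * c : R[i]^o)).
Proof.
have ReM (x y : R[i]) : complex.Re (x * y) =
  complex.Re x * complex.Re y - complex.Im x * complex.Im y by case: x; case: y.
have ImM (x y : R[i]) : complex.Im (x * y) =
  complex.Re x * complex.Im y + complex.Im x * complex.Re y by case: x; case: y.
move=> /cvg_complexP[fr fi]; apply/cvg_complexP; split.
  rewrite ReM; under eq_fun do rewrite ReM.
  by apply: cvgB; apply: cvgMl.
rewrite ImM; under eq_fun do rewrite ImM.
by apply: cvgD; apply: cvgMl.
Qed.

(** * Bounds on gamma and multiplicativity of alpha *)

Section alpha.
Variables (R : realType) (F : polyEulerProduct R).

Lemma invf_local_factor (p : nat) : (0 < p)%N ->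
  (local_factor F p 1)^-1 = 1 - gamma F p / p%:R.
Proof.
move=> p0; rewrite /gamma mulrAC divff ?pnatr_eq0 -?lt0n// !mul1r.
by rewrite opprB addrC subrK.
Qed.

Lemma npowc1 (p : nat) : (0 < p)%N -> npowc p 1 = p%:R :> R[i].
Proof.
move=> p0; rewrite /npowc /= mul1r mul0r cos0 sin0 lnK ?posrE ?ltr0n//.
by rewrite (_ : (1 : R) +i* 0 = 1) ?mulr1 ?rmorph_nat.
Qed.

(** The two bounds go through one induction because [1 - (1 - u) P = (1 - P) + u P] feeds the first
    into the second. The factor [e] in the second will be [1/p], compensating the factor [p] in
    [gamma]. *)
Lemma prod_sub1_bound (I : Type) (s : seq I) (u : I -> R[i]) (e : R) :
  0 <= e <= 1 -> (forall i, normc (u i) <= e) ->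
  normc (\prod_(i <- s) (1 - u i)) <= 2 ^+ size s /\
  normc (1 - \prod_(i <- s) (1 - u i)) <= e * 2 ^+ size s.
Proof.
move=> /andP[e0 e1] ue; elim: s => [|i s [IH1 IH2]].
  by rewrite big_nil subrr Normc.normc0 Normc.normc1 expr0 mulr1.
rewrite big_cons exprS; split.
  rewrite Normc.normcM ler_pM ?normc_ge0//.
  rewrite (le_trans (normcD _ _))// Normc.normc1 normcN lerD2l.
  exact: le_trans e1.
set P := \prod_(j <- s) _ in IH1 IH2 *.
have -> : 1 - (1 - u i) * P = (1 - P) + u i * P by ring.
rewrite (le_trans (normcD _ _))// Normc.normcM mulrCA mulr_natl mulr2n.
by rewrite lerD// ler_pM ?normc_ge0.
Qed.

Lemma normc_gamma_le (p : nat) : prime p ->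
  normc (gamma F p) <= 2 ^+ euler_degree F.
Proof.
move=> pp; have p0 := prime_gt0 pp.
have pR : 0 < p%:R :> R by rewrite ltr0n.
have -> : gamma F p = p%:R * (1 - (local_factor F p 1)^-1) by rewrite /gamma mul1r.
rewrite /local_factor prodfV invrK npowc1// Normc.normcM normc_nat.
rewrite -ler_pdivlMl//.
have := @prod_sub1_bound _ (enum 'I_(euler_degree F))
  (fun j => euler_coef p j / p%:R) p%:R^-1.
rewrite big_enum size_enum_ord; case=> //.
  by rewrite invr_ge0 ltW// invf_le1// ler1n.
move=> j; rewrite Normc.normcM Normc.normcV normc_nat ler_piMl ?invr_ge0 ?(ltW pR)//.
by rewrite -lecR -normrCE; exact: euler_coef_le1.
Qed.

Lemma alpha1 : alpha F 1 = 1.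
Proof. by rewrite /alpha /= big_nil mulr1. Qed.

Lemma alpha_mul_prime (p d : nat) : prime p -> (0 < d)%N -> ~~ (p %| d)%N ->
  alpha F (p * d) = - gamma F p * alpha F d.
Proof.
move=> pp d0 pd; rewrite /alpha.
rewrite (perm_big _ (primes_mul_prime pp d0 pd)) big_cons /=.
suff -> : moebius (p * d) = - moebius d by rewrite mulrNz mulNr mulNr mulrCA.
have := sqfree_mul_prime pp d0 pd; rewrite /moebius /sqfree => ->.
by case: ifP; rewrite ?oppr0// (perm_size (primes_mul_prime pp d0 pd)) exprS mulN1r.
Qed.

Lemma alpha_nsqfree (d : nat) : ~~ sqfree d -> alpha F d = 0.
Proof. by rewrite /alpha /moebius /sqfree => /negbTE ->; rewrite mul0r. Qed.

(** Each factor [F_p(1)^-1] equals [1 - gamma p / p]; expanding the product over [p] dividing [n]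
    produces the [alpha d / d]. *)
Lemma euler_totientE (n : nat) : (0 < n)%N ->
  euler_totient F n = n%:R * \sum_(d <- divisors n) alpha F d / d%:R.
Proof.
move=> n0; rewrite /euler_totient; congr (_ * _).
rewrite (sum_dvd_prod_primes (c := fun p => - gamma F p / p%:R)).
- rewrite big_seq [RHS]big_seq; apply: eq_bigr => p; rewrite mem_primes => /andP[pp _].
  by rewrite invf_local_factor ?prime_gt0// mulNr.
- by rewrite alpha1 divr1.
- by move=> p d pp d0 pd; rewrite alpha_mul_prime// natrM invfM mulrACA.
- by move=> d sd; rewrite alpha_nsqfree// mul0r.
- by [].
Qed.


Lemma normc_alpha_mul_prime (p d : nat) : prime p -> (0 < d)%N -> ~~ (p %| d)%N ->
  normc (alpha F (p * d)) / (p * d)%:R ^+ 2 =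
  normc (gamma F p) / p%:R ^+ 2 * (normc (alpha F d) / d%:R ^+ 2).
Proof.
move=> pp d0 pd; rewrite alpha_mul_prime// Normc.normcM normcN natrM exprMn.
by rewrite invfM mulrACA.
Qed.

(** By [1 + t <= exp t] it suffices to bound the sum of inverse squares, and
    [1/n^2 <= 2/(n(n+1)) = 2/n - 2/(n+1)] telescopes to the exponent shown. *)
Lemma prod_normc_gamma_le (N : nat) :
  \prod_(0 <= p < N.+1 | prime p) (1 + normc (gamma F p) / p%:R ^+ 2) <=
  expR (2 ^+ euler_degree F * (2 - 2 / N.+1%:R)) :> R.
Proof.
set B := 2 ^+ euler_degree F; have B0 : 0 <= B by rewrite exprn_ge0.
elim: N => [|N IH].
  by rewrite big_mkcond big_nat1 /= divr1 subrr mulr0 expR0.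
rewrite big_mkcond big_nat_recr//= -big_mkcond /=.
have N0 : (0 : R) < N.+1%:R by rewrite ltr0n.
have N1 : (0 : R) < N.+2%:R by rewrite ltr0n.
have step : expR (B * (2 - 2 / N.+2%:R)) =
    expR (B * (2 - 2 / N.+1%:R)) * expR (B * (2 / (N.+1%:R * N.+2%:R))) :> R.
  rewrite -expRD -mulrDr; congr (expR (_ * _)).
  move: N0 N1; rewrite -[N.+2%:R]natr1; move: (N.+1%:R : R) => y y0 y1.
  by field; rewrite !gt_eqF.
have pos : 0 <= B * (2 / (N.+1%:R * N.+2%:R)).
  by rewrite mulr_ge0// divr_ge0// mulr_ge0// ltW.
rewrite step; apply: ler_pM => //.
- apply: prodr_ge0 => p _; by rewrite addr_ge0// divr_ge0 ?normc_ge0 ?sqr_ge0.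
- by case: ifP => // _; rewrite addr_ge0// divr_ge0 ?normc_ge0 ?sqr_ge0.
case: ifP => [pp|_]; last by rewrite (le_trans _ (expR_ge1Dx _))// lerDl.
apply: le_trans (expR_ge1Dx _); rewrite lerD2l.
apply: ler_pM; rewrite ?normc_ge0 ?invr_ge0 ?sqr_ge0 ?normc_gamma_le//.
rewrite -lef_pV2 ?posrE ?invf_gt0 ?divr_gt0 ?mulr_gt0 ?exprn_gt0// invrK invf_div.
rewrite ler_pdivrMr// expr2 -mulrA ler_pM2l// mulr_natr mulr2n.
by rewrite -natrD ler_nat; lia.
Qed.

End alpha.

Lemma le_sum_subset (R : realType) (s r : seq nat) (k : nat -> R) :
  uniq s -> uniq r -> {subset s <= r} -> (forall n, 0 <= k n) ->
  \sum_(n <- s) k n <= \sum_(n <- r) k n.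
Proof.
move=> us ur sr k0.
have -> : \sum_(n <- s) k n = \sum_(n <- r | n \in s) k n.
  rewrite -[RHS]big_filter; apply: perm_big; apply: uniq_perm => //.
    by rewrite filter_uniq.
  by move=> n; rewrite mem_filter; have [/sr ->|] := boolP (n \in s).
by rewrite big_mkcond; apply: ler_sum => n _; case: ifP.
Qed.

(** * Absolute convergence of the series for [l] and its Euler product *)

Section euler_product_cvg.
Variables (R : realType) (F : polyEulerProduct R).

Let primes_below (N : nat) := [seq p <- index_iota 0 N | prime p].

Let primes_below_prime N : all prime (primes_below N).
Proof. exact: filter_all. Qed.

Let primes_below_uniq N : uniq (primes_below N).
Proof. by rewrite filter_uniq// iota_uniq. Qed.

Let mem_primes_below N p : (p \in primes_below N) = prime p && (p < N)%N.
Proof. by rewrite mem_filter mem_index_iota. Qed.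

Let k (n : nat) : R := normc (alpha F n) / n%:R ^+ 2.

Let k_ge0 n : 0 <= k n.
Proof. by rewrite divr_ge0 ?normc_ge0 ?sqr_ge0. Qed.

Let k_nsqfree n : ~~ sqfree n -> k n = 0.
Proof. by move=> /(alpha_nsqfree F); rewrite /k => ->; rewrite Normc.normc0 mul0r. Qed.

Let subset_prods_below N n : (n < N)%N -> sqfree n -> n \in subset_prods (primes_below N).
Proof.
move=> nN sn; rewrite mem_subset_prods// sn /=; apply/allP => p.
rewrite /= mem_primes mem_primes_below => /and3P[-> n0 pn] /=.
exact: leq_ltn_trans (dvdn_leq n0 pn) nN.
Qed.

(** A squarefree number below [N] has all its prime factors below [N], so the expanded product
    contains the whole partial sum. With [k] this bounds the partial sums; with [alpha n / n^2] it
    identifies the limit. *)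
Let sum_subset_prods_below (V : nmodType) (h : nat -> V) N :
  (forall n, ~~ sqfree n -> h n = 0) ->
  \sum_(d <- subset_prods (primes_below N)) h d =
  \sum_(1 <= n < N) h n + \sum_(d <- subset_prods (primes_below N) | (N <= d)%N) h d.
Proof.
move=> h0; rewrite (bigID (fun d => (d < N)%N)) /=; congr (_ + _); last first.
  by apply: eq_bigl => d; rewrite -leqNgt.
rewrite [RHS](bigID sqfree) /= [X in _ = _ + X]big1// addr0.
rewrite -big_filter -[RHS]big_filter; apply: perm_big; apply: uniq_perm.
- by rewrite filter_uniq// subset_prods_uniq.
- by rewrite filter_uniq// iota_uniq.
move=> n; rewrite !mem_filter mem_index_iota.
apply/andP/and3P => [[nN]|[sn n1 nN]]; last by rewrite subset_prods_below.
by rewrite mem_subset_prods// => /andP[sn _]; split=> //; case/andP: sn.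
Qed.

Let sum_k_prod N : \sum_(d <- subset_prods (primes_below N)) k d =
  \prod_(0 <= p < N | prime p) (1 + normc (gamma F p) / p%:R ^+ 2).
Proof.
rewrite (sum_subset_prods (c := fun p => normc (gamma F p) / p%:R ^+ 2))//.
- by rewrite big_filter.
- by rewrite /k alpha1 Normc.normc1 expr1n divr1.
- exact: normc_alpha_mul_prime.
Qed.

Let sum_k_bounded N : \sum_(1 <= n < N) k n <= expR (2 ^+ euler_degree F * 2).
Proof.
apply: (@le_trans _ _ (\sum_(1 <= n < N.+1) k n)).
  case: N => [|N]; first by rewrite !big_geq.
  by rewrite [leRHS]big_nat_recr//= lerDl.
apply: (@le_trans _ _ (\sum_(d <- subset_prods (primes_below N.+1)) k d)).
  rewrite sum_subset_prods_below; last exact: k_nsqfree.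
  by rewrite lerDl; apply: sumr_ge0.
rewrite sum_k_prod; apply: (le_trans (prod_normc_gamma_le F N)).
rewrite ler_expR ler_wpM2l ?exprn_ge0// gerBl divr_ge0//.
Qed.

Let sum_k_nd : nondecreasing_seq (fun N => \sum_(1 <= n < N) k n).
Proof.
apply/nondecreasing_seqP => -[|n]; first by rewrite !big_geq.
by rewrite [leRHS]big_nat_recr//= lerDl.
Qed.

Let sum_k_cvg : cvgn (fun N => \sum_(1 <= n < N) k n).
Proof.
apply: nondecreasing_is_cvgn => //.
by exists (expR (2 ^+ euler_degree F * 2)) => _ [N _ <-].
Qed.

Let kE n : normc (alpha F n / n%:R ^+ 2) = k n.
Proof. by rewrite Normc.normcM Normc.normcV -natrX normc_nat natrX. Qed.

Let bounded_by_k_cvg (u : nat -> R) : (forall n, `|u n| <= k n) ->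
  cvgn (fun N => \sum_(1 <= n < N) u n).
Proof.
(* The convention [0^-1 = 0] gives [k 0 = 0], so starting the series at 0 instead of 1 changes
   nothing. *)
move=> uk; have k0 : k 0 = 0 by rewrite /k expr0n invr0 mulr0.
have u0 : u 0 = 0 by apply/eqP; rewrite -normr_le0 -[leRHS]k0.
have E (v : nat -> R) : v 0 = 0 -> (fun N => \sum_(1 <= n < N) v n) = series v.
  move=> v0; apply/funext => -[|N]; rewrite /series /=.
    by rewrite !big_geq.
  by rewrite [RHS]big_ltn// v0 add0r.
rewrite E//; apply: normed_cvg.
apply: (series_le_cvg _ k_ge0 uk) => //.
by rewrite -E.
Qed.

Lemma sum_alpha_sq_cvg : exists l : R[i]^o,
  ((\sum_(1 <= n < N) alpha F n / n%:R ^+ 2) : R[i]^o) @[N --> \oo] --> l.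
Proof.
have cr : cvgn (fun N => \sum_(1 <= n < N) complex.Re (alpha F n / n%:R ^+ 2)).
  by apply: bounded_by_k_cvg => n; rewrite -kE Re_le_normc.
have ci : cvgn (fun N => \sum_(1 <= n < N) complex.Im (alpha F n / n%:R ^+ 2)).
  by apply: bounded_by_k_cvg => n; rewrite -kE Im_le_normc.
exists (limn (fun N => \sum_(1 <= n < N) complex.Re (alpha F n / n%:R ^+ 2)) +i*
  limn (fun N => \sum_(1 <= n < N) complex.Im (alpha F n / n%:R ^+ 2))).
apply/cvg_complexP; split => /=.
  by under eq_fun do rewrite raddf_sum.
by under eq_fun do rewrite raddf_sum.
Qed.

Let tail_le N : \sum_(d <- subset_prods (primes_below N) | (N <= d)%N) k d <=
  limn (fun N => \sum_(1 <= n < N) k n) - \sum_(1 <= n < N) k n.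
Proof.
rewrite lerBrDl -sum_subset_prods_below; last exact: k_nsqfree.
set s := subset_prods _.
(* The finitely many elements of [s] are at most their maximum, so their sum is dominated by a
   longer partial sum, hence by the limit. *)
apply: (@le_trans _ _ (\sum_(1 <= n < (\max_(d <- s) d).+1) k n)).
  apply: le_sum_subset => //; rewrite ?iota_uniq ?subset_prods_uniq//.
  move=> d ds; rewrite mem_index_iota ltnS leq_bigmax_seq// andbT.
  by move: ds; rewrite mem_subset_prods// => /andP[/andP[]].
exact: nondecreasing_cvgn_le.
Qed.

(* The product over p < N is the sum over squarefree n with all prime factors
   below N; the terms with n >= N are bounded by the tail of an absolutely
   convergent series. *)
Lemma C_constE (l : R[i]^o) :
  ((\sum_(1 <= n < N) alpha F n / n%:R ^+ 2) : R[i]^o) @[N --> \oo] --> l ->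
  C_const F = 2^-1 * l.
Proof.
move=> hl; rewrite /C_const; congr (_ * _).
apply: (@cvg_lim R[i]^o); first exact: norm_hausdorff.
have tail0 : limn (fun N => \sum_(1 <= n < N) k n) - \sum_(1 <= n < N) k n @[N --> \oo] --> 0.
  rewrite -[X in _ --> X](subrr (limn (fun N => \sum_(1 <= n < N) k n))).
  by apply: cvgB => //; exact: cvg_cst.
have prodE N : \prod_(0 <= p < N | prime p) (1 - gamma F p / p%:R ^+ 2) =
    \sum_(1 <= n < N) alpha F n / n%:R ^+ 2 +
    \sum_(d <- subset_prods (primes_below N) | (N <= d)%N) alpha F d / d%:R ^+ 2.
  rewrite -sum_subset_prods_below; last first.
    by move=> n sn; rewrite alpha_nsqfree// mul0r.
  rewrite (sum_subset_prods (c := fun p => - gamma F p / p%:R ^+ 2))//.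
  - by rewrite big_filter; apply: eq_bigr => p _; rewrite mulNr.
  - by rewrite alpha1 expr1n divr1.
  - by move=> p d pp d0 pd; rewrite alpha_mul_prime// natrM exprMn invfM mulrACA.
under eq_fun do rewrite prodE.
rewrite -[X in nbhs X](addr0 (l : R[i])).
apply: (cvg_complexD _ hl).
apply/cvgr0Pnorm_lt => e e0.
have eE : e = (complex.Re e)%:C by rewrite RRe_real// ger0_real// ltW.
have e20 : 0 < complex.Re e by rewrite -ltcR -eE.
move/cvgr0Pnorm_lt : tail0 => /(_ _ e20); apply: filterS => N tN.
rewrite eE; apply: (le_lt_trans (ler_norm_sum _ _ _)).
under eq_bigr do rewrite normrCE kE.
rewrite -rmorph_sum /= ltcR.
apply: (le_lt_trans (tail_le N)); apply: le_lt_trans tN; exact: ler_norm.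
Qed.
End euler_product_cvg.

(** * The homogeneous Volterra equation *)

(* Cutting [a, b] into n pieces bounds |g b - g a| by K (b - a)^2 / n. *)
Lemma quadratic_increments_cst (R : realType) (g : R -> R) (a b K : R) : a <= b ->
  (forall y x, a <= y -> y <= x -> x <= b -> `|g x - g y| <= K * (x - y) ^+ 2) ->
  g a = g b.
Proof.
move=> ab gK; apply/eqP; rewrite eq_sym -subr_eq0 -normr_le0 leNgt; apply/negP => e0.
set e := `|g b - g a| in e0.
(* So many pieces that [K (b - a)^2 / n] falls below the supposed increment [e]. *)
set n := (Num.truncn (K * (b - a) ^+ 2 / e)).+1.
have n0 : 0 < n%:R :> R by rewrite ltr0n.
have nK : K * (b - a) ^+ 2 < n%:R * e by rewrite -ltr_pdivrMr// truncnS_gt.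
pose h := (b - a) / n%:R.
have h0 : 0 <= h by rewrite divr_ge0 ?subr_ge0// ltW.
have nh : n%:R * h = b - a by rewrite /h mulrC divfK// gt_eqF.
have step i : (i <= n)%N -> `|g (a + i%:R * h) - g a| <= i%:R * (K * h ^+ 2).
  elim: i => [|i IH] lin; first by rewrite mul0r addr0 subrr normr0 mul0r.
  have -> : g (a + i.+1%:R * h) - g a =
    (g (a + i.+1%:R * h) - g (a + i%:R * h)) + (g (a + i%:R * h) - g a) by ring.
  rewrite (le_trans (ler_normD _ _))// -[i.+1%:R]natr1 [in leRHS]mulrDl mul1r addrC.
  apply: lerD; first exact/IH/ltnW.
  have -> : K * h ^+ 2 = K * (a + (i%:R + 1) * h - (a + i%:R * h)) ^+ 2.
    by congr (_ * _ ^+ 2); ring.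
  apply: gK; first by rewrite lerDl mulr_ge0.
    by rewrite lerD2l ler_wpM2r// lerDl.
  rewrite natr1 -lerBrDl -nh ler_wpM2r// ler_nat//.
have := step n (leqnn _); rewrite nh (addrC a) subrK -/e => eh.
have : n%:R * e <= K * (b - a) ^+ 2.
  rewrite -nh; apply: le_trans (_ : n%:R * (n%:R * (K * h ^+ 2)) <= _).
    by rewrite ler_wpM2l// ltW.
  by rewrite le_eqVlt; apply/orP; left; apply/eqP; ring.
by rewrite leNgt nK.
Qed.

(** Used twice: [c = 0] turns a bound on [g] into a Lipschitz bound for its integral, and [c = g y]
    gains a second factor [x - y]. *)
Lemma le_Rintegral_affine (R : realType) (g : R -> R) (y x c K : R) : y <= x ->
  (completed_mu R).-integrable [set` `]y, x]] (EFin \o g) ->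
  (forall t, y < t -> t <= x -> `|g t - c| <= K) ->
  `|\int[completed_mu R]_(t in `]y, x]) g t - c * (x - y)| <= K * (x - y).
Proof.
move=> yx gi gK.
have mD := @measurable_itv_lebesgue R `]y, x].
have ic (d : R) : (completed_mu R).-integrable [set` `]y, x]] (EFin \o (fun=> d)).
  by apply: (bounded_integrable_oc (M := `|d|)).
have cst (d : R) : \int[completed_mu R]_(t in `]y, x]) d = d * (x - y).
  by rewrite Rintegral_cst// [X in d * fine X](completed_mu_oc yx).
rewrite -!cst -RintegralB//.
have iB : (completed_mu R).-integrable [set` `]y, x]] (EFin \o (fun t => g t - c)).
  exact: (integrableB mD gi (ic c)).
apply: (le_trans (le_normr_Rintegral _ _)) => //.
apply: le_Rintegral => //.
  exact: (integrable_abse iB).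
by move=> t /=; rewrite in_itv/= => /andP[? ?]; exact: gK.
Qed.

Lemma volterra_homogeneous (R : realType) (D : R -> R) :
  (forall x, 0 < x -> (completed_mu R).-integrable [set` `]0, x]] (EFin \o (fun t => D t / t))) ->
  (forall x, 0 <= x -> D x = \int[completed_mu R]_(t in `]0, x]) (D t / t)) ->
  forall x, 0 <= x -> D x = D 1 * x.
Proof.
move=> gi DE; pose g t := D t / t.
have Dg t : 0 < t -> D t = t * g t by move=> t0; rewrite /g mulrC divfK// gt_eqF.
(* At [x = 0] the integral runs over the empty set, so [D 0 = 0]; elsewhere compare [g x] with
   [g 1]. *)
suff gcst a b : 0 < a -> a <= b -> g a = g b.
  move=> x; rewrite le_eqVlt => /predU1P[<-|x0].
    rewrite mulr0 DE// set_itv_ge ?bnd_simp// Rintegral_set0//.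
  rewrite (Dg x x0) mulrC; congr (_ * _); rewrite -[RHS]divr1 -/(g 1).
  by have [x1|/ltW x1] := leP x 1; [apply: gcst|apply/esym/gcst].
move=> a0 ab; have b0 := lt_le_trans a0 ab.
have gi' y x : 0 <= y -> y < x -> (completed_mu R).-integrable [set` `]y, x]] (EFin \o g).
  move=> y0 yx; apply: integrableS (gi x (le_lt_trans y0 yx)); try exact: measurable_itv_lebesgue.
  by move=> t /=; rewrite !in_itv/= => /andP[yt ->]; rewrite (le_lt_trans y0 yt).
have split_int (k : R -> R) y x : 0 < y -> y < x ->
    (completed_mu R).-integrable [set` `]0, x]] (EFin \o k) ->
    \int[completed_mu R]_(t in `]0, x]) k t =
    \int[completed_mu R]_(t in `]0, y]) k t + \int[completed_mu R]_(t in `]y, x]) k t.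
  move=> y0 yx ki; have yxE : [set` `]0, x]] = [set` `]0, y]] `|` [set` `]y, x]] :> set R.
    apply/seteqP; split => t /=; rewrite !in_itv/=.
      by move=> /andP[t0 tx]; have [ty|ty] := leP t y; [left|right]; apply/andP.
    by case=> /andP[h1 h2]; apply/andP; split; lra.
  rewrite yxE Rintegral_setU//; try exact: measurable_itv_lebesgue.
    by rewrite yxE in ki.
  apply/disj_setPS => t /= []; rewrite !in_itv/= => /andP[_ ty] /andP[yt _].
  by move: (lt_le_trans yt ty); rewrite ltxx.
(* The equation itself bounds [D] on []0, b]] by the total mass of [|g|]. *)
pose M := \int[completed_mu R]_(t in `]0, b]) `|g t|.
have DM t : 0 < t -> t <= b -> `|D t| <= M.
  move=> t0 tb; rewrite DE ?(ltW t0)//.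
  apply: (le_trans (le_normr_Rintegral (measurable_itv_lebesgue _) (gi t t0))).
  move: tb; rewrite le_eqVlt => /predU1P[->//|tb].
  rewrite /M (split_int _ t b)// ?lerDl ?Rintegral_ge0//.
  exact: (integrable_abse (gi b b0)).
have M0 : 0 <= M by apply: Rintegral_ge0.
have DB y x : 0 < y -> y < x -> D x - D y = \int[completed_mu R]_(t in `]y, x]) g t.
  move=> y0 yx; have x0 := lt_trans y0 yx.
  rewrite (DE x) ?(ltW x0)// (DE y) ?(ltW y0)// (split_int _ y x)//; last exact: gi.
  by rewrite addrAC subrr add0r.
have DL y x : a <= y -> y < x -> x <= b -> `|D x - D y| <= M / a * (x - y).
  move=> ay yx xb; have y0 := lt_le_trans a0 ay.
  rewrite DB//; have := @le_Rintegral_affine R g y x 0 (M / a) (ltW yx).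
  rewrite mul0r subr0; apply; first exact: gi' (ltW y0) yx.
  move=> t yt tx; rewrite subr0 /g normrM.
  have t0 := lt_trans y0 yt.
  rewrite ler_pM// ?DM// ?(le_trans tx)// ger0_norm ?invr_ge0 ?(ltW t0)//.
  by rewrite lef_pV2// ltW// (le_lt_trans ay).
(* The increment of [D / t] splits into one part from [D] and one from [1/t]; each is at most
   [M / a^2] times the increment of [t]. *)
pose L := M / a ^+ 2 *+ 2.
have gL y t : a <= y -> y < t -> t <= b -> `|g t - g y| <= L * (t - y).
  move=> ay yt tb; have y0 := lt_le_trans a0 ay; have t0 := lt_trans y0 yt.
  have -> : g t - g y = (D t - D y) / t - D y * ((t - y) / (t * y)).
    by rewrite /g; field; rewrite !gt_eqF.
  apply: (le_trans (ler_normB _ _)); rewrite /L mulr2n [leRHS]mulrDl; apply: lerD.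
    have -> : M / a ^+ 2 * (t - y) = M / a * (t - y) / a by field; rewrite gt_eqF.
    rewrite normrM ler_pM ?DL// ger0_norm ?invr_ge0 ?(ltW t0)// lef_pV2//.
    by rewrite ltW// (le_lt_trans ay).
  rewrite normrM -mulrA ler_pM// ?DM// ?(le_trans (ltW yt))//.
  rewrite normrM (ger0_norm (_ : 0 <= t - y)) ?subr_ge0 ?(ltW yt)// mulrC.
  rewrite ler_wpM2r ?subr_ge0 ?(ltW yt)// ger0_norm ?invr_ge0 ?mulr_ge0 ?(ltW t0) ?(ltW y0)//.
  rewrite lef_pV2 ?posrE ?mulr_gt0// expr2 ler_pM ?(ltW a0)//.
  by rewrite ltW// (le_lt_trans ay).
(* [x (g x - g y)] is the integral of [g t - g y] over []y, x]], at most [L (x - y)^2]; dividing by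
   [x >= a] gives the constant. *)
apply: (@quadratic_increments_cst _ _ _ _ (L / a)) => // y x ay + xb.
rewrite le_eqVlt => /predU1P[->|yx]; first by rewrite !subrr normr0 expr0n mulr0.
have y0 := lt_le_trans a0 ay; have x0 := lt_trans y0 yx.
have L0 : 0 <= L by rewrite mulrn_wge0// divr_ge0 ?sqr_ge0.
have : `|x * (g x - g y)| <= L * (x - y) * (x - y).
  have -> : x * (g x - g y) = D x - D y - g y * (x - y).
    by rewrite (Dg x)// (Dg y)//; ring.
  rewrite DB//; apply: le_Rintegral_affine; [exact: ltW|exact: gi' (ltW y0) yx|].
  move=> t yt tx; apply: (le_trans (gL _ _ ay yt (le_trans tx xb))).
  by rewrite ler_wpM2l// lerD2r.
rewrite normrM (ger0_norm (ltW x0)) => hx.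
have -> : L / a * (x - y) ^+ 2 = (L * (x - y) * (x - y)) / a by field; rewrite gt_eqF.
rewrite ler_pdivlMr//; apply: le_trans hx; rewrite mulrC ler_wpM2r//.
by rewrite ltW// (le_lt_trans ay).
Qed.

(** * Improper absolute convergence at 0 versus Lebesgue integrability *)

Lemma measurable_inv_oc (R : realType) (x : R) :
  measurable_fun (`]0, x] : set (lebesgueType R)) (fun t : R => t^-1).
Proof.
apply: borel_lebesgue_fun => //.
apply: (@measurable_funS _ _ R R [set` `]0, +oo[]) => //.
  by move=> t /=; rewrite !in_itv/= andbT => /andP[].
apply: open_continuous_measurable_fun; first exact: interval_open.
by move=> t; rewrite inE/= in_itv/= andbT => t0; apply: inv_continuous; rewrite gt_eqF.
Qed.

Lemma measurable_normc_div (R : realType) (G : R -> R[i]) (x : R) :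
  measurable_fun (`]0, x] : set (lebesgueType R)) (fun t => complex.Re (G t) : R) ->
  measurable_fun (`]0, x] : set (lebesgueType R)) (fun t => complex.Im (G t) : R) ->
  measurable_fun (`]0, x] : set (lebesgueType R)) (fun t : R => normc (G t) / t).
Proof.
move=> mr mi; apply: measurable_funM; last exact: measurable_inv_oc.
rewrite (_ : (fun _ => _) = Num.sqrt \o
  (fun t => complex.Re (G t) ^+ 2 + complex.Im (G t) ^+ 2)); last first.
  by apply/funext => t /=; case: (G t).
apply: measurableT_comp.
  by apply: continuous_measurable_fun; exact: sqrt_continuous.
by apply: measurable_funD; exact: measurable_funX.
Qed.

(** [|G(t)| / t] is at most [2 M], so the integrals over [[eps, x]] stay below [2 M x]; they grow as
    [eps] decreases, hence converge to a finite supremum. *)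
Lemma bounded_abs_int_dt_t (R : realType) (G : R -> R[i]) (gr gi : R -> R) (x M : R) :
  0 <= x -> measurable_fun setT gr -> measurable_fun setT gi ->
  (forall t, 0 < t <= x -> G t = (gr t +i* gi t) * t%:C) ->
  (forall t, 0 < t <= x -> `|gr t| <= M) ->
  (forall t, 0 < t <= x -> `|gi t| <= M) -> abs_int_dt_t G x.
Proof.
move=> x0 mgr mgi GE grM giM.
have mRe : measurable_fun (`]0, x] : set (lebesgueType R)) (fun t : R => complex.Re (G t) : R).
  apply: (@eq_measurable_fun _ _ (lebesgueType R) R _ (fun t : R => gr t * t)).
    by move=> t; rewrite inE/= in_itv/= => /GE ->; rewrite /= mulr0 subr0.
  apply: borel_lebesgue_fun => //; apply: measurable_funM => //.
  exact: measurable_funTS.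
have mIm : measurable_fun (`]0, x] : set (lebesgueType R)) (fun t : R => complex.Im (G t) : R).
  apply: (@eq_measurable_fun _ _ (lebesgueType R) R _ (fun t : R => gi t * t)).
    by move=> t; rewrite inE/= in_itv/= => /GE ->; rewrite /= mulr0 add0r.
  apply: borel_lebesgue_fun => //; apply: measurable_funM => //.
  exact: measurable_funTS.
split => //.
have mw := measurable_normc_div mRe mIm.
have mw' : measurable_fun (`]0, x] : set (lebesgueType R))
    (fun t : R => (normc (G t) / t)%:E) by apply/measurable_EFinP.
have w0 (t : R) : 0 <= t -> 0 <= normc (G t) / t.
  by move=> t0; rewrite divr_ge0 ?normc_ge0.
pose f (eps : R) := (\int[completed_mu R]_(t in `[eps, x]) (normc (G t) / t)%:E)%E.
have sub (u v : R) : 0 < u -> u <= v -> [set` `[v, x]] `<=` [set` `[u, x]].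
  by move=> u0 uv t /=; rewrite !in_itv/= => /andP[vt ->]; rewrite (le_trans uv).
have sub0 (u : R) : 0 < u -> [set` `[u, x]] `<=` [set` `]0, x]].
  by move=> u0 t /=; rewrite !in_itv/= => /andP[ut ->]; rewrite (lt_le_trans u0).
have f0 u : 0 < u -> (0 <= f u)%E.
  move=> u0; apply: integral_ge0 => t /(sub0 _ u0) /=.
  by rewrite in_itv/= lee_fin => /andP[/ltW t0 _]; exact: w0.
have fnd : {in `]0, +oo[ &, nonincreasing_fun f}.
  move=> u v; rewrite !in_itv/= !andbT => u0 v0 uv.
  apply: ge0_subset_integral; try exact: measurable_itv_lebesgue.
  - by apply: measurable_funS mw'; [exact: measurable_itv_lebesgue|exact: sub0].
  - move=> t /(sub0 _ u0) /=.
    by rewrite in_itv/= lee_fin => /andP[/ltW t0 _]; exact: w0.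
  - exact: sub.
have fM u : 0 < u -> (f u <= ((M + M) * x)%:E)%E.
  move=> u0; apply: (@le_trans _ _
    (\int[completed_mu R]_(t in `]0%R, x]) (normc (G t) / t)%:E)%E).
    apply: ge0_subset_integral => //; try exact: measurable_itv_lebesgue.
      by move=> t /=; rewrite in_itv/= lee_fin => /andP[/ltW t0 _]; exact: w0.
    exact: sub0.
  apply: (@le_trans _ _ (\int[completed_mu R]_(t in `]0%R, x]) (cst (M + M)%:E t))%E).
    apply: ge0_le_integral => //; try exact: measurable_itv_lebesgue.
    - by move=> t /=; rewrite in_itv/= lee_fin => /andP[/ltW t0 _]; exact: w0.
    - move=> t /= ; rewrite in_itv/= => tx; have t0 : 0 < t by case/andP: tx.
      rewrite lee_fin ler_pdivrMr// GE// Normc.normcM.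
      have -> : normc t%:C = t by rewrite /= expr0n addr0 sqrtr_sqr gtr0_norm.
      rewrite ler_wpM2r ?(ltW t0)// (le_trans (normc_le_ReIm _))//=.
      by rewrite lerD ?grM ?giM.
  rewrite integral_cst; last exact: measurable_itv_lebesgue.
  by rewrite [X in (_ * X)%E](completed_mu_oc x0) subr0 -EFinM.
have fcvg : f u @[u --> 0^'+] --> ereal_sup (f @` [set` `]0, +oo[]).
  by apply: nonincreasing_at_right_cvge => //; rewrite bnd_simp.
set S := ereal_sup _ in fcvg.
have S0 : (0 <= S)%E.
  apply: (le_trans (f0 1 ltr01)); apply: ereal_sup_ubound.
  by exists 1 => //=; rewrite in_itv/= andbT.
have SM : (S <= ((M + M) * x)%:E)%E.
  by apply: ub_ereal_sup => _ [u /= + <-]; rewrite in_itv/= andbT; exact: fM.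
have Sfin : S \is a fin_num by rewrite ge0_fin_numE// (le_lt_trans SM) ?ltry.
by exists (fine S); rewrite fineK.
Qed.

(** Monotone convergence along [eps = 1/(n+1)] identifies the improper limit with the integral over
    []0, x]]; real and imaginary parts are then dominated by the modulus. *)
Lemma abs_int_dt_t_integrable (R : realType) (G : R -> R[i]) (x : R) :
  0 < x -> abs_int_dt_t G x ->
  (completed_mu R).-integrable [set` `]0, x]] (EFin \o (fun t => complex.Re (G t) / t)) /\
  (completed_mu R).-integrable [set` `]0, x]] (EFin \o (fun t => complex.Im (G t) / t)).
Proof.
move=> x0 [mRe mIm [l fl]].
have mw := measurable_normc_div mRe mIm.
have mw' : measurable_fun (`]0, x] : set (lebesgueType R))
    (fun t : R => (normc (G t) / t)%:E) by apply/measurable_EFinP.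
have w0 (t : R) : 0 <= t -> 0 <= normc (G t) / t.
  by move=> t0; rewrite divr_ge0 ?normc_ge0.
have sub0 (u : R) : 0 < u -> [set` `[u, x]] `<=` [set` `]0, x]].
  by move=> u0 t /=; rewrite !in_itv/= => /andP[ut ->]; rewrite (lt_le_trans u0).
have n0 (n : nat) : 0 < n.+1%:R^-1 :> R by rewrite invr_gt0 ltr0n.
pose J (n : nat) : set (lebesgueType R) := [set` `[n.+1%:R^-1, x]].
have UE : \bigcup_n J n = [set` `]0, x]].
  apply/seteqP; split => [t [n _]|t /=]; first exact: sub0.
  rewrite in_itv/= => /andP[t0 tx]; exists (Num.truncn t^-1) => //=.
  rewrite /J /= in_itv/= tx andbT -[leRHS]invrK lef_pV2 ?posrE ?invr_gt0 ?ltr0n//.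
  by rewrite ltW// truncnS_gt.
have c1 : (\int[completed_mu R]_(t in J n) (normc (G t) / t)%:E
   @[n --> \oo] --> \int[completed_mu R]_(t in `]0%R, x]) (normc (G t) / t)%:E)%E.
  rewrite -UE; apply: ge0_nondecreasing_set_cvg_integral.
  - apply/nondecreasing_seqP => n; apply/subsetPset => t; rewrite /J /= !in_itv/=.
    move=> /andP[nt ->]; rewrite andbT; apply: le_trans nt.
    by rewrite lef_pV2 ?posrE ?ltr0n// ler_nat.
  - by move=> n; exact: measurable_itv_lebesgue.
  - move=> n; apply: measurable_funS mw'; first exact: measurable_itv_lebesgue.
    exact: sub0.
  - move=> n t /(sub0 _ (n0 n)) /=.
    by rewrite in_itv/= lee_fin => /andP[/ltW t0 _]; exact: w0.
have c2 : (\int[completed_mu R]_(t in J n) (normc (G t) / t)%:E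
   @[n --> \oo] --> l%:E)%E.
  apply: cvg_comp fl => A [e /= e0 eA].
  have := @cvg_harmonic R; move/cvgrPdist_lt => /(_ e e0); apply: filterS => n hn.
  exact: eA.
have intE : (\int[completed_mu R]_(t in `]0%R, x]) (normc (G t) / t)%:E)%E = l%:E.
  exact: cvg_unique c1 c2.
have wi : (completed_mu R).-integrable [set` `]0, x]] (fun t : R => (normc (G t) / t)%:E).
  apply/integrableP; split => //.
  rewrite (_ : (\int[_]_(t in _) _)%E = l%:E) ?ltry// -intE.
  apply: eq_integral => t; rewrite inE/= in_itv/= => /andP[/ltW t0 _].
  by rewrite ger0_norm// w0.
have dom (h : R -> R) : measurable_fun (`]0, x] : set (lebesgueType R)) h ->
    (forall t, `|h t| <= normc (G t)) ->
    (completed_mu R).-integrable [set` `]0, x]] (EFin \o (fun t => h t / t)).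
  move=> mh hG; apply: le_integrable wi; first exact: measurable_itv_lebesgue.
    by apply/measurable_EFinP/measurable_funM => //; exact: measurable_inv_oc.
  move=> t _; rewrite lee_fin !normrM ler_wpM2r//.
  by rewrite [leRHS]ger0_norm ?normc_ge0.
by split; apply: dom => // t; [exact: Re_le_normc|exact: Im_le_normc].
Qed.

(** * Explicit formulas for [f1] and [E2] *)

(* The sum counts the multiples of n up to x, i.e. the integer part of x / n. *)
Lemma sawtoothE (R : realType) (x : R) (n N : nat) :
  0 < x -> x < N%:R -> (0 < n)%N ->
  sawtooth (x / n%:R) =
  2^-1 - x / n%:R + \sum_(1 <= m < N) (n %| m)%N%:R * half_step x m.
Proof.
move=> x0 xN n0; have nR : 0 < n%:R :> R by rewrite ltr0n.
set X := Num.truncn x.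
have [Xx xX] : X%:R <= x /\ x < X.+1%:R by apply/andP/truncn_itv/ltW.
have XN : (X.+1 <= N)%N by rewrite -(ltr_nat R) (le_lt_trans Xx).
have leX m : (m%:R <= x) = (m <= X)%N by rewrite truncn_ge_nat// ltW.
have count : \sum_(1 <= m < N) (n %| m)%N%:R * (m%:R <= x)%R%:R = (X %/ n)%:R :> R.
  rewrite (big_cat_nat (n := X.+1))//= [X in _ + X]big1_seq ?addr0.
    rewrite divn_count_dvd natr_sum; apply: eq_big_nat => m /andP[_ mX].
    by rewrite leX -ltnS mX mulr1.
  by move=> m; rewrite mem_index_iota leX => /andP[_ /andP[Xm _]]; rewrite leqNgt Xm mulr0.
have floorE : Num.floor (x / n%:R) = (X %/ n)%N.
  apply: floor_def.
  rewrite (_ : (X %/ n)%N%:Z + 1 = (X %/ n).+1%:Z); last by rewrite -addn1 PoszD.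
  rewrite -!pmulrn ler_pdivlMr// ltr_pdivrMr// -!natrM leX leq_trunc_div /=.
  by apply: (lt_le_trans xX); rewrite ler_nat ltn_ceil.
(* The half weights detect exactly whether [x / n] is an integer, where they cancel the [1/2] and
   bring the sawtooth to 0. *)
have ptE : \sum_(1 <= m < N) (n %| m)%N%:R * (x == m%:R)%:R = (x / n%:R \is a Num.int)%:R :> R.
  have [xint|xnint] := boolP (x / n%:R \is a Num.int).
    have xE : x = ((X %/ n) * n)%:R.
      have xq : x / n%:R = (X %/ n)%N%:R by rewrite -[LHS](floorK xint) floorE.
      by rewrite natrM -xq divfK// gt_eqF.
    have m0 : (0 < X %/ n * n)%N by rewrite -(ltr_nat R) -xE.
    have mN : (X %/ n * n < N)%N by rewrite -(ltr_nat R) -xE.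
    rewrite (big_rem (X %/ n * n)%N) ?mem_index_iota ?m0//=.
    rewrite dvdn_mull// -xE eqxx mulr1 big1_seq ?addr0//.
    move=> m /andP[_]; rewrite mem_rem_uniq ?iota_uniq// inE => /andP[mE _].
    by rewrite xE eqr_nat eq_sym (negbTE mE) mulr0.
  rewrite big1// => m _; have [/dvdnP[q mE]|] := boolP (n %| m)%N; last by rewrite mul0r.
  case: eqP => [xm|]; last by rewrite mulr0.
  by case/negP: xnint; rewrite xm mE natrM mulfK ?gt_eqF// rpred_nat.
rewrite /half_step; under eq_bigr do rewrite mulrBr mulrCA.
rewrite sumrB -mulr_sumr count ptE /sawtooth floorE.
case: ifPn => xint; last by rewrite mulr0 subr0 -pmulrn; ring.
have -> : x / n%:R = (X %/ n)%:R by rewrite -[LHS](floorK xint) floorE.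
by rewrite mulr1; ring.
Qed.

Lemma ReMr (R : realType) (z : R[i]) (r : R) : complex.Re (z * r%:C) = complex.Re z * r.
Proof. by case: z => u v /=; rewrite mulr0 subr0. Qed.

Lemma ImMr (R : realType) (z : R[i]) (r : R) : complex.Im (z * r%:C) = complex.Im z * r.
Proof. by case: z => u v /=; rewrite mulr0 add0r. Qed.

(** * Existence and uniqueness for the integral equation *)

Section volterra.
Variables (R : realType) (F : polyEulerProduct R) (a l : R[i]^o).
Hypothesis cvg_a : ((\sum_(1 <= n < N) alpha F n / n%:R) : R[i]^o) @[N --> \oo] --> a.
Hypothesis cvg_l : ((\sum_(1 <= n < N) alpha F n / n%:R ^+ 2) : R[i]^o) @[N --> \oo] --> l.

(** Both sums are finite, and [N <= K] ensures that every divisor of an [m < N] occurs among the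
    [n < K], so the inner sum is the full divisor sum for [phi(m)/m]. *)
Lemma sum_alpha_sawtooth (x : R) (N K : nat) : 0 < x -> x < N%:R -> (N <= K)%N ->
  \sum_(1 <= n < K) alpha F n / n%:R * (sawtooth (x / n%:R))%:C =
  (\sum_(1 <= n < K) alpha F n / n%:R) * 2^-1
  + (\sum_(1 <= n < K) alpha F n / n%:R ^+ 2) * (- x%:C)
  + \sum_(1 <= m < N) euler_totient F m / m%:R * (half_step x m)%:C.
Proof.
move=> x0 xN NK.
have -> : \sum_(1 <= m < N) euler_totient F m / m%:R * (half_step x m)%:C =
    \sum_(1 <= m < N) \sum_(1 <= n < K)
      alpha F n / n%:R * ((n %| m)%N%:R * half_step x m)%:C.
  apply: eq_big_nat => m /andP[m0 mN].
  rewrite euler_totientE// (mulrAC m%:R) divff ?pnatr_eq0 -?lt0n// mul1r mulr_suml.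
  rewrite [LHS](_ : _ = \sum_(n <- index_iota 1 K | (n %| m)%N) alpha F n / n%:R * (half_step x m)%:C).
    rewrite big_mkcond; apply: eq_bigr => n _.
    by case: ifP => _; rewrite ?mul1r// mul0r mulr0.
  rewrite -[RHS]big_filter; apply: perm_big; apply: uniq_perm.
  - exact: divisors_uniq.
  - by rewrite filter_uniq// iota_uniq.
  move=> n; rewrite mem_filter mem_index_iota -dvdn_divisors//.
  have [nm|//] := boolP (n %| m)%N.
  by rewrite (dvdn_gt0 m0 nm) (leq_ltn_trans (dvdn_leq m0 nm))// (leq_trans mN).
rewrite exchange_big /= !mulr_suml -!big_split /=; apply: eq_big_nat => n /andP[n0 _].
rewrite (sawtoothE x0 xN n0) rmorphD rmorphB /= mulrDr mulrBr rmorph_sum mulr_sumr.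
congr (_ + _); rewrite fmorphV rmorph_nat mulrN rmorphM fmorphV rmorph_nat.
by rewrite expr2 invfM; ring.
Qed.

Lemma f1E (x : R) (N : nat) : 0 < x -> x < N%:R ->
  f1 F x = a * 2^-1 + l * (- x%:C) +
  \sum_(1 <= m < N) euler_totient F m / m%:R * (half_step x m)%:C.
Proof.
move=> x0 xN; rewrite /f1; apply: (@cvg_lim R[i]^o); first exact: norm_hausdorff.
set S := \sum_(1 <= m < N) _.
have H : ((\sum_(1 <= n < K) alpha F n / n%:R) * 2^-1
  + (\sum_(1 <= n < K) alpha F n / n%:R ^+ 2) * (- x%:C) + S : R[i]^o) @[K --> \oo] -->
  (a * 2^-1 + l * (- x%:C) + S : R[i]^o).
  apply: cvg_complexD; last exact: cvg_cst.
  by apply: cvg_complexD; apply: cvg_complexZl.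
apply: cvg_trans H; apply: near_eq_cvg; exists N => // K /= NK.
by rewrite (sum_alpha_sawtooth x0 xN NK).
Qed.

Lemma sum_half_step (f : nat -> R[i]) (x : R) (N : nat) : 0 < x -> x < N%:R ->
  \sum_(1 <= m < N) f m * (half_step x m)%:C =
  \sum_(1 <= m < (Num.truncn x).+1) f m -
  (if x \is a Num.nat then f (Num.truncn x) / 2 else 0).
Proof.
move=> x0 xN; set X := Num.truncn x.
have [Xx xX] : X%:R <= x /\ x < X.+1%:R by apply/andP/truncn_itv/ltW.
have XN : (X.+1 <= N)%N by rewrite -(ltr_nat R) (le_lt_trans Xx).
have leX m : (m%:R <= x) = (m <= X)%N by rewrite truncn_ge_nat// ltW.
under eq_bigr do rewrite /half_step rmorphB mulrBr.
rewrite sumrB; congr (_ - _).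
  rewrite (big_cat_nat (n := X.+1))//= [X in _ + X]big1_seq ?addr0.
    by apply: eq_big_nat => m /andP[_ mX]; rewrite leX -ltnS mX mulr1.
  by move=> m; rewrite mem_index_iota leX => /andP[_ /andP[Xm _]]; rewrite leqNgt Xm mulr0.
case: ifPn => [/natrP[k xk]|xn]; last first.
  rewrite big1// => m _; case: eqP => [xm|_]; last by rewrite mulr0 mulr0.
  by case/negP: xn; rewrite xm rpred_nat.
have Xk : X = k by rewrite /X xk natrK.
have k0 : (0 < k)%N by rewrite -(ltr_nat R) -xk.
have kN : (k < N)%N by rewrite -(ltr_nat R) -xk.
rewrite (big_rem k) ?mem_index_iota ?k0//= big1_seq ?addr0.
  by rewrite xk eqxx mulr1 fmorphV rmorph_nat Xk.
move=> m /andP[_]; rewrite mem_rem_uniq ?iota_uniq// inE => /andP[mk _].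
by rewrite xk eqr_nat eq_sym (negbTE mk) !mulr0.
Qed.

(** Where the integer part is constant, [E_err] is a constant minus a multiple of [t^2]. A general
    filter [G] covers the left limit ([k - 1]) and the right limit ([k]) at once. *)
Lemma E_err_cvg (G : set_system R) (FG : Filter G) (x : R) (k : nat) :
  t @[t --> G] --> x -> (\forall t \near G, Num.truncn t = k) ->
  ((E_err F t : R[i]^o) @[t --> G] -->
   (\sum_(1 <= n < k.+1) euler_totient F n + (x ^+ 2)%:C * (- C_const F) : R[i]^o)).
Proof.
move=> tx tk; set S := \sum_(1 <= n < _) _.
have H : ((S + (t ^+ 2)%:C * (- C_const F) : R[i]^o) @[t --> G] -->
    (S + (x ^+ 2)%:C * (- C_const F) : R[i]^o)).
  apply: cvg_complexD; first exact: cvg_cst.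
  apply: cvg_complexZl; apply/cvg_complexP; split => /=; last exact: cvg_cst.
  by rewrite expr2; under eq_fun do rewrite expr2; exact: cvgM.
apply: cvg_trans H; apply: near_eq_cvg.
by apply: filterS tk => t tk; rewrite /E_err tk mulrN [_ * C_const F]mulrC.
Qed.

(** At an integer [k] the one-sided sums stop at [k - 1] and at [k]; their mean gives the last term
    weight 1/2, as [half_step] does. *)
Lemma E2E (x : R) (N : nat) : 0 < x -> x < N%:R ->
  E2 F x = \sum_(1 <= m < N) euler_totient F m * (half_step x m)%:C
           - 2^-1 * l * (x ^+ 2)%:C.
Proof.
move=> x0 xN; rewrite sum_half_step// -(C_constE cvg_l) /E2 x0 /=.
case: ifPn => [/natrP[k xk]|_]; last by rewrite subr0.
have k0 : (0 < k)%N by rewrite -(ltr_nat R) -xk.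
have kE : k = k.-1.+1 by rewrite prednK.
have L : lim ((E_err F t : R[i]^o) @[t --> x^'-]) =
    \sum_(1 <= n < k) euler_totient F n + (x ^+ 2)%:C * (- C_const F).
  apply: (@cvg_lim R[i]^o); first exact: norm_hausdorff.
  rewrite {1}kE; apply: E_err_cvg; first by apply: cvg_at_left_filter; exact: cvg_id.
  near=> t; apply: truncn_def; rewrite -kE -xk; apply/andP; split; near: t.
    apply: nbhs_left_ge; rewrite xk ltr_nat prednK//.
  exact: nbhs_left_lt.
have Rl : lim ((E_err F t : R[i]^o) @[t --> x^'+]) =
    \sum_(1 <= n < k.+1) euler_totient F n + (x ^+ 2)%:C * (- C_const F).
  apply: (@cvg_lim R[i]^o); first exact: norm_hausdorff.
  apply: E_err_cvg; first by apply: cvg_at_right_filter; exact: cvg_id.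
  near=> t; apply: truncn_def; rewrite -xk; apply/andP; split; near: t.
    exact: nbhs_right_ge.
  by apply: nbhs_right_lt; rewrite xk ltr_nat.
rewrite L Rl xk natrK big_nat_recr//=.
by field.
Unshelve. all: by end_near. Qed.

Let c (m : nat) : R[i] := euler_totient F m / m%:R.

Let c_mul (m : nat) : (0 < m)%N -> euler_totient F m = c m * m%:R.
Proof. by move=> m0; rewrite /c divfK// pnatr_eq0 -lt0n. Qed.

Let f1_step (A : R[i]) (x : R) (N : nat) : 0 < x -> x < N%:R ->
  f1 F x + A =
  step_affine (complex.Re (a / 2 + A)) (- complex.Re l) (fun m => complex.Re (c m)) N x +i*
  step_affine (complex.Im (a / 2 + A)) (- complex.Im l) (fun m => complex.Im (c m)) N x.
Proof.
move=> x0 xN; rewrite (f1E x0 xN) -rmorphN /step_affine.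
apply/eqP; rewrite eq_complex /= !raddfD !raddf_sum /= !ReMr !ImMr.
apply/andP; split; apply/eqP.
  under eq_bigr do rewrite ReMr; rewrite /half_step mulrN mulNr.
  by rewrite addrAC; congr (_ + _); rewrite addrAC.
under eq_bigr do rewrite ImMr; rewrite /half_step mulrN mulNr.
by rewrite addrAC; congr (_ + _); rewrite addrAC.
Qed.

(** The constant [p] cancels, so [a/2] and [A] disappear; [q x^2] loses half of itself; a jump turns
    from [x - (x - m)] into [m], with half of it at [x = m]. Hence weights [phi(m)/m] become
    [phi(m)]. *)
Let real_equation (p q : R) (d : nat -> R) (x : R) (N : nat) : 0 < x ->
  step_affine p q d N x * x -
  \int[completed_mu R]_(t in `]0, x]) step_affine p q d N t =
  \sum_(1 <= m < N) d m * m%:R * half_step x m + q / 2 * x ^+ 2.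
Proof.
move=> x0; rewrite Rintegral_step_affine// /step_affine mulrDl mulr_suml.
rewrite opprD addrACA -sumrB addrC; congr (_ + _); last by field.
apply: eq_bigr => m _; rewrite -mulrA -mulrBr -mulrA; congr (_ * _).
rewrite /half_step; case: (ltgtP x m%:R) => [xm|xm|<-] /=; rewrite ?mulr0 ?mulr1; by field.
Qed.

Lemma volterra_f1 (A : R[i]) : volterra_solution F (fun x => (f1 F x + A) * x%:C).
Proof.
move=> x x0; set G := fun x : R => _.
pose N := (Num.truncn x).+1; have xN : x < N%:R := truncnS_gt x.
pose gr := step_affine (complex.Re (a / 2 + A)) (- complex.Re l) (fun m => complex.Re (c m)) N.
pose gi := step_affine (complex.Im (a / 2 + A)) (- complex.Im l) (fun m => complex.Im (c m)) N.
have GE t : 0 < t <= x -> G t = (gr t +i* gi t) * t%:C.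
  by move=> /andP[t0 tx]; rewrite /G (f1_step A t0 (le_lt_trans tx xN)).
split.
  have [M1 _ gM1] := step_affine_bounded (complex.Re (a / 2 + A)) (- complex.Re l)
    (fun m => complex.Re (c m)) N x0.
  have [M2 _ gM2] := step_affine_bounded (complex.Im (a / 2 + A)) (- complex.Im l)
    (fun m => complex.Im (c m)) N x0.
  apply: (@bounded_abs_int_dt_t _ _ gr gi _ (Num.max M1 M2)) => //;
    try exact: measurable_step_affine.
    by move=> t tx; rewrite le_max gM1.
  by move=> t tx; rewrite le_max gM2 ?orbT.
(* At [x = 0] the integral is empty, and [E2] falls back on [E_err], whose sum is empty too. *)
move: x0; rewrite le_eqVlt => /predU1P[<-|x0].
  rewrite /int_dt_t set_itv_ge ?bnd_simp// !Rintegral_set0 /G mulr0 subr0.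
  by rewrite /E2 ltxx /E_err truncn0 big_geq// expr0n mulr0 subr0.
have intE : int_dt_t G x = (\int[completed_mu R]_(t in `]0, x]) gr t) +i*
    (\int[completed_mu R]_(t in `]0, x]) gi t).
  rewrite /int_dt_t; congr (_ +i* _); apply: eq_Rintegral => t;
    rewrite inE/= in_itv/= => tx; rewrite GE// ?ReMr ?ImMr mulfK//;
    by case/andP: tx => t0 _; rewrite gt_eqF.
have xx : 0 < x <= x by rewrite x0 lexx.
rewrite intE -[(f1 F x + A) * x%:C]/(G x) GE// (E2E x0 xN).
have cE (m : nat) : (1 <= m < N)%N ->
    euler_totient F m * (half_step x m)%:C = c m * (m%:R * half_step x m)%:C.
  by move=> /andP[m0 _]; rewrite (c_mul m0) rmorphM rmorph_nat mulrA.
rewrite (eq_big_nat _ _ cE).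
apply/eqP; rewrite eq_complex !raddfB !raddf_sum /= !ReMr !ImMr /=.
rewrite /gr /gi !mulr0 subr0 add0r !real_equation//.
have l2 : (2^-1 * l : R[i]) = l * (2^-1)%:C by rewrite fmorphV rmorph_nat mulrC.
rewrite l2 !ReMr !ImMr.
apply/andP; split; apply/eqP; congr (_ + _).
- by apply: eq_bigr => m _; rewrite ReMr mulrA.
- by rewrite -!mulNr.
- by apply: eq_bigr => m _; rewrite ImMr mulrA.
- by rewrite -!mulNr.
Qed.

(** Subtracting the particular solution with [A = 0] leaves a homogeneous equation, solved
    separately for real and imaginary parts. *)
Lemma volterra_unique (F1 : R -> R[i]) : volterra_solution F F1 ->
  exists A : R[i], forall x, 0 <= x -> F1 x = (f1 F x + A) * x%:C.
Proof.
move=> sF1; pose G0 x := (f1 F x + 0) * x%:C.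
have sG0 : volterra_solution F G0 by exact: volterra_f1.
pose D x := F1 x - G0 x.
have i1 x (x0 : 0 < x) := abs_int_dt_t_integrable x0 (sF1 x (ltW x0)).1.
have i2 x (x0 : 0 < x) := abs_int_dt_t_integrable x0 (sG0 x (ltW x0)).1.
have DE x : 0 <= x -> D x = int_dt_t F1 x - int_dt_t G0 x.
  move=> x0; have [_ e1] := sF1 x x0; have [_ e2] := sG0 x x0.
  by rewrite /D -(subrK (int_dt_t F1 x) (F1 x)) e1 -(subrK (int_dt_t G0 x) (G0 x)) e2; ring.
have Re_hom x : 0 <= x -> complex.Re (D x) = complex.Re (D 1) * x.
  apply: (volterra_homogeneous (D := fun x => complex.Re (D x))) => {}x x0.
    have := integrableB (measurable_itv_lebesgue _) (i1 x x0).1 (i2 x x0).1.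
    by apply: eq_integrable => [|t _] /=; [exact: measurable_itv_lebesgue|
      rewrite /D raddfB mulrBl].
  move: x0; rewrite le_eqVlt => /predU1P[<-|x0].
    by rewrite DE// /int_dt_t set_itv_ge ?bnd_simp// !Rintegral_set0 subrr.
  under eq_Rintegral do rewrite raddfB mulrBl.
  by rewrite RintegralB ?DE ?(ltW x0)//; [exact: measurable_itv_lebesgue|
    exact: (i1 x x0).1|exact: (i2 x x0).1].
have Im_hom x : 0 <= x -> complex.Im (D x) = complex.Im (D 1) * x.
  apply: (volterra_homogeneous (D := fun x => complex.Im (D x))) => {}x x0.
    have := integrableB (measurable_itv_lebesgue _) (i1 x x0).2 (i2 x x0).2.
    by apply: eq_integrable => [|t _] /=; [exact: measurable_itv_lebesgue|
      rewrite /D raddfB mulrBl].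
  move: x0; rewrite le_eqVlt => /predU1P[<-|x0].
    by rewrite DE// /int_dt_t set_itv_ge ?bnd_simp// !Rintegral_set0 subrr.
  under eq_Rintegral do rewrite raddfB mulrBl.
  by rewrite RintegralB ?DE ?(ltW x0)//; [exact: measurable_itv_lebesgue|
    exact: (i1 x x0).2|exact: (i2 x x0).2].
(* The homogeneous part is linear in [x], so its value at 1 is the constant sought. *)
exists (D 1) => x x0.
have Dx : D x = D 1 * x%:C.
  by apply/eqP; rewrite eq_complex ReMr ImMr Re_hom// Im_hom// !eqxx.
have -> : F1 x = D x + G0 x by rewrite /D subrK.
by rewrite Dx /G0; ring.
Qed.
End volterra.

Theorem theorem2p1 (R : realType) (F : polyEulerProduct R)
    (alpha_cvg : cvgn (fun N : nat =>
       (\sum_(1 <= n < N) alpha F n / n%:R) : R[i]^o)) :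
  (forall A : R[i],
     volterra_solution F (fun x : R => (f1 F x + A) * x%:C)) /\
  (forall F1 : R -> R[i], volterra_solution F F1 ->
     exists A : R[i], forall x : R, 0 <= x -> F1 x = (f1 F x + A) * x%:C).
Proof.
have [l cvg_l] := sum_alpha_sq_cvg F.
by split; [exact: (volterra_f1 alpha_cvg cvg_l)|exact: (volterra_unique alpha_cvg cvg_l)].
Qed.
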